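(* Let $(a_n)_{n\ge1}$ be a sequence of complex numbers, and let $(n_k)_{k\ge1}$ be a lacunary sequence of positive integers of ratio $r>1$, i.e. $\frac{n_{k+1}}{n_k}\ge r>1$ for all $k\ge1$. If $p,q\in(1,\infty)$ are such that $\frac1p+\frac1q=1$, then $$\Big(\sum_{k=1}^\infty\Big|\frac{1}{n_k^{1/q}}\sum_{j=1}^{n_k} a_j\Big|^p\Big)^{1/p}\le \frac{r^{1/q}}{r^{1/q}-1}\,\Big(\sum_{n=1}^\infty|a_n|^p\Big)^{1/p}.$$
   Context: The inequality is understood in $[0,+\infty]$, and is trivially true when the right-hand side is $+\infty$. *)

(* Defs.v *)
From mathcomp Require Import all_boot all_order all_algebra.
From mathcomp Require Import all_classical all_reals all_analysis.

Local Open Scope ring_scope.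

(* [r] is the ratio. Sequences indexed by k >= 1 are functions on nat whose
   value at 0 is irrelevant. *)
Definition lacunary {R : realType} (n : nat -> nat) (r : R) : Prop :=
  1 < r /\ forall k : nat, (1 <= k)%N -> r <= (n k.+1)%:R / (n k)%:R.

(* Main.v *)
Require Import Defs.
From mathcomp Require Import all_boot all_order all_algebra.
From mathcomp Require Import all_classical all_reals all_analysis.
From mathcomp Require Import complex.
From mathcomp Require Import ring lra.
Import Order.TTheory GRing.Theory Num.Theory.
Import ComplexField.Normc.
Local Open Scope ring_scope.
Local Open Scope complex_scope.

(** Write b_k for the k-th normalised partial sum on the left-hand side, with
    b_0 = 0, and split its sum at n_{k-1} into the previous partial sum and the
    sum over the block (n_{k-1}, n_k]. With theta = r^(-1/q) < 1, lacunarity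
    turns this into the recursion
      b_k <= theta * b_{k-1} + c_k,
    where c_k = n_k^(-1/q) * |sum of a over the k-th block|
    ([lacunary_mean_recursion]). Such a recursion is inverted in l^p at the cost
    of the factor 1 / (1 - theta), which is the constant of the theorem: by
    convexity of x |-> x^p,
      b_k^p <= theta * b_{k-1}^p + (1 - theta) * (c_k / (1 - theta))^p,
    and summation over k absorbs the first term of the right-hand side
    ([geometric_recursion_sum_powR]); this plays the role of Young's convolution
    inequality for the kernel (theta^j), whose l^1 norm is 1 / (1 - theta).

    The power mean inequality ([powR_sum_le]) on a block, which has at most n_k
    elements, gives c_k^p <= sum of |a_j|^p over the block, since
    p / q = p - 1. The blocks are consecutive, so these bounds add up to a
    partial sum of the series of the |a_j|^p. Only finite sums intervene until
    the last step, where the number of terms tends to infinity. *)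

(** * Convexity of the power function *)

(** Two-point Jensen inequality, with weights that need not add up to 1: the
    homogeneous form serves both [powR_sum_le], with integer weights, and
    [geometric_recursion_sum_powR]. *)
Lemma powR_weighted_sum_le (R : realType) (p u v x y : R) :
  1 <= p -> 0 <= u -> 0 <= v -> 0 < u + v -> 0 <= x -> 0 <= y ->
  (u * x + v * y) `^ p <= (u + v) `^ (p - 1) * (u * x `^ p + v * y `^ p).
Proof.
move=> p1 u0 v0 uv0 x0 y0.
have uvN : u + v != 0 by rewrite gt_eqF.
pose t := u / (u + v).
have t0 : 0 <= t by rewrite divr_ge0// ltW.
have t1 : t <= 1 by rewrite ler_pdivrMr// mul1r lerDl.
have jensen : (t * x + (1 - t) * y) `^ p <= t * x `^ p + (1 - t) * y `^ p.
  by apply: (convex_powR p1 (Itv01 t0 t1)); rewrite inE/= in_itv/= andbT.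
have -> : u * x + v * y = (u + v) * (t * x + (1 - t) * y).
  by rewrite /t; field.
have -> : u * x `^ p + v * y `^ p =
          (u + v) * (t * x `^ p + (1 - t) * y `^ p).
  by rewrite /t; field.
clearbody t; have t1' : 0 <= 1 - t by rewrite subr_ge0.
rewrite powRM ?(ltW uv0) ?addr_ge0 ?mulr_ge0// [leRHS]mulrA.
have -> : (u + v) `^ (p - 1) * (u + v) = (u + v) `^ p.
  by rewrite -[X in _ * X]powRr1 ?(ltW uv0)// -powRD ?subrK// uvN implybT.
by rewrite ler_wpM2l ?powR_ge0.
Qed.

Lemma powR_gt1 (R : realType) (x y : R) : 1 < x -> 0 < y -> 1 < x `^ y.
Proof.
move=> x1 y0; have x0 : 0 < x by rewrite (lt_trans ltr01).
suff : 1 `^ y < x `^ y by rewrite powR1.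
by rewrite gt0_ltr_powR// nnegrE ltW.
Qed.

Lemma powR_sum_le (R : realType) (I : Type) (s : seq I) (x : I -> R) (p : R) :
  1 <= p -> (forall i, 0 <= x i) ->
  (\sum_(i <- s) x i) `^ p <=
    (size s)%:R `^ (p - 1) * \sum_(i <- s) x i `^ p.
Proof.
move=> p1 x0; have p0 : p != 0 by rewrite gt_eqF// (lt_le_trans ltr01).
elim: s => [|i s IHs]; first by rewrite !big_nil powR0// mulr0.
rewrite !big_cons /=.
case: s IHs => [|i' s'] IHs.
  by rewrite !big_nil !addr0 powR1 mul1r.
set s := i' :: s' in IHs *; set S := \sum_(j <- s) x j in IHs *.
have S0 : 0 <= S by rewrite sumr_ge0.
have N0 : 0 < (size s)%:R :> R by rewrite ltr0n.
have NN : (size s)%:R != 0 :> R by rewrite gt_eqF.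
have SN0 : 0 <= S / (size s)%:R by rewrite divr_ge0// ltW.
(* the sum over s enters as (size s) copies of its mean *)
have -> : x i + S = 1 * x i + (size s)%:R * (S / (size s)%:R).
  by rewrite mul1r mulrCA mulfV// mulr1.
apply: le_trans (powR_weighted_sum_le _ _ _ _ _ _ p1 _ _ _ _ _) _ => //.
rewrite nat1r ler_wpM2l ?powR_ge0// mul1r lerD2l.
rewrite -(ler_pM2l (powR_gt0 (p - 1) N0)) mulrA.
apply: le_trans _ IHs.
rewrite -[X in _ * X * _]powRr1 ?(ltW N0)// -powRD ?subrK ?NN ?implybT//.
by rewrite -powRM ?(ltW N0)// mulrCA mulfV// mulr1.
Qed.

(** * Recursions with a geometric weight *)

(** The term th * b_k^p is kept on the left in the induction: it is what the
    next step of the recursion consumes. *)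
Lemma geometric_recursion_sum_powR (R : realType) (p th : R) (b c : nat -> R) :
  1 <= p -> 0 <= th -> th < 1 -> b 0%N = 0 ->
  (forall k, 0 <= b k) -> (forall k, 0 <= c k) ->
  (forall k, b k.+1 <= th * b k + c k) ->
  forall K, \sum_(0 <= k < K) b k.+1 `^ p <=
            (1 - th)^-1 `^ p * \sum_(0 <= k < K) c k `^ p.
Proof.
move=> p1 th0 th1 b00 b0 c0 bc K.
have p0 : 0 < p by rewrite (lt_le_trans ltr01).
have th'0 : 0 < 1 - th by rewrite subr_gt0.
have th'i0 : 0 <= (1 - th)^-1 by rewrite invr_ge0 ltW.
pose d k := ((1 - th)^-1 * c k) `^ p.
have step k : b k.+1 `^ p <= th * b k `^ p + (1 - th) * d k.
  apply: (@le_trans _ _ ((th * b k + (1 - th) * ((1 - th)^-1 * c k)) `^ p)).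
    rewrite mulrA mulfV ?gt_eqF// mul1r ge0_ler_powR ?nnegrE ?(ltW p0)//.
    by rewrite addr_ge0 ?mulr_ge0.
  have := powR_weighted_sum_le _ p th (1 - th) (b k) ((1 - th)^-1 * c k).
  rewrite (addrC th) subrK powR1 mul1r; apply => //; first exact: ltW.
  by rewrite mulr_ge0.
have -> : (1 - th)^-1 `^ p * \sum_(0 <= k < K) c k `^ p =
          \sum_(0 <= k < K) d k.
  by rewrite mulr_sumr; apply: eq_bigr => k _; rewrite /d powRM.
have inv : (1 - th) * \sum_(0 <= k < K) b k.+1 `^ p + th * b K `^ p <=
           (1 - th) * \sum_(0 <= k < K) d k.
  elim: K => [|K IHK].
    by rewrite !big_geq// b00 powR0 ?gt_eqF// !mulr0 addr0.
  rewrite !big_nat_recr//= !mulrDr.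
  have := step K; lra.
rewrite -(ler_pM2l th'0); apply: le_trans inv.
by rewrite lerDl mulr_ge0 ?powR_ge0.
Qed.

(** * Sums over the blocks of a lacunary sequence *)

Lemma normc_ge0 (R : rcfType) (z : R[i]) : 0 <= normc z.
Proof. by case: z => x y; rewrite sqrtr_ge0. Qed.

Lemma normc_real (R : rcfType) (x : R) : 0 <= x -> normc x%:C = x.
Proof. by move=> x0; rewrite /normc/= expr0n addr0 sqrtr_sqr ger0_norm. Qed.

Lemma normc_sum_le (R : rcfType) (I : Type) (s : seq I) (z : I -> R[i]) :
  normc (\sum_(i <- s) z i) <= \sum_(i <- s) normc (z i).
Proof.
elim: s => [|i s IHs]; first by rewrite !big_nil normc0.
by rewrite !big_cons (le_trans (le_normcD _ _))// lerD2l.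
Qed.

Lemma sum_consecutive_blocks (V : nmodType) (f : nat -> V) (N : nat -> nat) K :
  (forall k, (N k <= N k.+1)%N) ->
  \sum_(0 <= k < K) \sum_((N k).+1 <= j < (N k.+1).+1) f j =
  \sum_((N 0%N).+1 <= j < (N K).+1) f j.
Proof.
move=> Nle; elim: K => [|K IHK]; first by rewrite !big_geq.
rewrite big_nat_recr//= IHK -big_cat_nat//= ltnS; last exact: Nle.
by elim: K {IHK} => // K /leq_trans; apply.
Qed.

(** [normalized_sum a s N] is the modulus that is summed on the left-hand side,
    for N = n_k and s = 1 / q. *)
Definition normalized_sum {R : realType} (a : nat -> R[i]) (s : R) (N : nat) :=
  normc ((1 / N%:R `^ s)%:C * \sum_(1 <= j < N.+1) a j).

Definition normalized_block {R : realType} (a : nat -> R[i]) (s : R)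
    (M N : nat) :=
  1 / N%:R `^ s * normc (\sum_(M.+1 <= j < N.+1) a j).

Lemma normalized_sumE (R : realType) (a : nat -> R[i]) (s : R) (N : nat) :
  normalized_sum a s N = 1 / N%:R `^ s * normc (\sum_(1 <= j < N.+1) a j).
Proof. by rewrite /normalized_sum normcM normc_real// divr_ge0 ?powR_ge0. Qed.

(** Passing from the normalisation at M to the one at N multiplies the partial
    sum up to M by (M / N)^s <= r^(-s). *)
Lemma lacunary_mean_recursion (R : realType) (a : nat -> R[i]) (s r : R)
    (M N : nat) :
  0 < s -> 0 < r -> (0 < N)%N -> (M <= N)%N -> r * M%:R <= N%:R ->
  normalized_sum a s N <=
    (r `^ s)^-1 * normalized_sum a s M + normalized_block a s M N.
Proof.
move=> s0 r0 N0 MN rMN; rewrite !normalized_sumE /normalized_block.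
have Ns0 : 0 < N%:R `^ s :> R by rewrite powR_gt0// ltr0n.
have rs0 : 0 < r `^ s by rewrite powR_gt0.
rewrite (@big_cat_nat _ _ _ M.+1)//=.
apply: le_trans (ler_wpM2l _ (le_normcD _ _)) _; first by rewrite divr_ge0// ltW.
rewrite mulrDr lerD2r.
case: M => [|M] in MN rMN *; first by rewrite big_geq// normc0 !mulr0.
have Ms0 : 0 < M.+1%:R `^ s :> R by rewrite powR_gt0// ltr0n.
rewrite mulrA ler_wpM2r ?normc_ge0// !div1r -invfM.
rewrite lef_pV2 ?posrE// ?mulr_gt0// -powRM ?(ltW r0)//.
by rewrite ge0_ler_powR ?nnegrE ?(ltW s0)// mulr_ge0// ltW.
Qed.

(** The factor (N - M)^(p - 1) of the power mean inequality is compensated by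
    the normalisation, as s * p = p - 1. *)
Lemma normalized_block_powR_le (R : realType) (a : nat -> R[i]) (s p : R)
    (M N : nat) :
  1 <= p -> s * p = p - 1 -> (0 < N)%N ->
  normalized_block a s M N `^ p <=
    \sum_(M.+1 <= j < N.+1) normc (a j) `^ p.
Proof.
move=> p1 sp N0; rewrite /normalized_block.
have p0 : 0 <= p by rewrite (le_trans ler01).
have Np0 : 0 < N%:R `^ (p - 1) :> R by rewrite powR_gt0// ltr0n.
rewrite div1r powRM ?normc_ge0 ?invr_ge0 ?powR_ge0//.
rewrite -powR_inv1 ?powR_ge0// -!powRrM mulN1r mulrN sp powRN.
rewrite ler_pdivrMl//.
apply: (@le_trans _ _ ((\sum_(M.+1 <= j < N.+1) normc (a j)) `^ p)).
  rewrite ge0_ler_powR ?nnegrE ?normc_ge0 ?sumr_ge0// ?normc_sum_le//.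
  by move=> *; exact: normc_ge0.
apply: le_trans (powR_sum_le _ _ _ _ _ p1 _) _ => [j|]; first exact: normc_ge0.
rewrite ler_wpM2r ?sumr_ge0//; first by move=> *; exact: powR_ge0.
rewrite ge0_ler_powR ?nnegrE ?subr_ge0//.
by rewrite size_iota subSS ler_nat leq_subr.
Qed.

Lemma lacunary_partial_sum_le (R : realType) (a : nat -> R[i]) (N : nat -> nat)
    (r s p : R) :
  1 <= p -> 0 < s -> s * p = p - 1 -> 1 < r -> N 0%N = 0%N ->
  (forall k, (0 < N k.+1)%N) -> (forall k, r * (N k)%:R <= (N k.+1)%:R) ->
  forall K, \sum_(0 <= k < K) normalized_sum a s (N k.+1) `^ p <=
    (r `^ s / (r `^ s - 1)) `^ p *
      \sum_(1 <= j < (N K).+1) normc (a j) `^ p.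
Proof.
move=> p1 s0 sp r1 N00 Npos Nr K.
have r0 : 0 < r by rewrite (lt_trans ltr01).
have Nle k : (N k <= N k.+1)%N.
  by rewrite -(ler_nat R) (le_trans _ (Nr k))// ler_peMl// ltW.
have rs1 : 1 < r `^ s by exact: powR_gt1.
have rsN : r `^ s != 0 by rewrite gt_eqF// (lt_trans ltr01).
have rs1N : r `^ s - 1 != 0 by rewrite gt_eqF// subr_gt0.
have -> : r `^ s / (r `^ s - 1) = (1 - (r `^ s)^-1)^-1.
  by field; rewrite rs1N rsN.
pose b k := normalized_sum a s (N k).
pose c k := normalized_block a s (N k) (N k.+1).
have c0 k : 0 <= c k.
  by rewrite mulr_ge0 ?normc_ge0// divr_ge0 ?powR_ge0.
apply: le_trans (_ : _ <= (1 - (r `^ s)^-1)^-1 `^ p *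
                          \sum_(0 <= k < K) c k `^ p) _.
  apply: (geometric_recursion_sum_powR _ p (r `^ s)^-1 b c) => //.
  - by rewrite invr_ge0 powR_ge0.
  - by rewrite invf_lt1// (lt_trans ltr01).
  - by rewrite /b N00 normalized_sumE big_geq// normc0 mulr0.
  - by move=> k; exact: normc_ge0.
  - by move=> k; apply: lacunary_mean_recursion.
rewrite ler_wpM2l ?powR_ge0//.
have <- : \sum_(0 <= k < K) \sum_((N k).+1 <= j < (N k.+1).+1) normc (a j) `^ p
         = \sum_(1 <= j < (N K).+1) normc (a j) `^ p.
  by rewrite sum_consecutive_blocks// N00.
by apply: ler_sum => k _; apply: normalized_block_powR_le.
Qed.

(** * Passage to the limit *)

Theorem corollary1 (R : realType) (a : nat -> R[i]) (n : nat -> nat)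
    (r p q : R)
    (n_pos : forall k : nat, (1 <= k)%N -> (0 < n k)%N)
    (n_lac : lacunary n r)
    (p_gt1 : 1 < p) (q_gt1 : 1 < q) (pq : 1 / p + 1 / q = 1) :
  ((\sum_(1 <= k <oo)
      ((normc ((1 / (n k)%:R `^ (1 / q))%:C * \sum_(1 <= j < (n k).+1) a j)%R)
         `^ p)%:E) `^ (1 / p)
   <= (r `^ (1 / q) / (r `^ (1 / q) - 1))%:E
      * (\sum_(1 <= m <oo) ((normc (a m)) `^ p)%:E) `^ (1 / p))%E.
Proof.
have [r1 n_ratio] := n_lac.
have p0 : 0 < p by rewrite (lt_trans ltr01).
have q0 : 0 < q by rewrite (lt_trans ltr01).
have s0 : 0 < 1 / q by rewrite divr_gt0.
have sp : 1 / q * p = p - 1.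
  have -> : 1 / q = 1 - 1 / p by apply/eqP; rewrite eq_sym subr_eq addrC pq.
  by rewrite mulrBl divfK ?gt_eqF// mul1r.
set s := 1 / q in s0 sp *.
set C := r `^ s / (r `^ s - 1).
have rs1 : 1 < r `^ s by exact: powR_gt1.
have C0 : 0 <= C by rewrite divr_ge0 ?powR_ge0// subr_ge0 ltW.
(* the value at 0 makes the first block start at the index 1 *)
pose N k := if k is k'.+1 then n k'.+1 else 0%N.
have Nr k : r * (N k)%:R <= (N k.+1)%:R.
  case: k => [|k] /=; first by rewrite mulr0.
  by rewrite -ler_pdivlMr ?n_ratio// ltr0n n_pos.
have partial := lacunary_partial_sum_le _ a N r s p (ltW p_gt1) s0 sp r1 erefl
  (fun k => n_pos k.+1 isT) Nr.
set A := (\sum_(1 <= m <oo) (normc (a m) `^ p)%:E)%E.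
have A0 : (0 <= A)%E by apply: nneseries_ge0 => *; rewrite lee_fin powR_ge0.
have sum_le : (\sum_(1 <= k <oo) (normalized_sum a s (n k) `^ p)%:E <=
               (C `^ p)%:E * A)%E.
  apply: lime_le.
    by apply: is_cvg_nneseries => *; rewrite lee_fin powR_ge0.
  apply: nearW => K; rewrite sumEFin.
  case: K => [|K].
    by rewrite big_geq// mule_ge0// lee_fin powR_ge0.
  rewrite big_add1/=.
  apply: (@le_trans _ _ ((C `^ p)%:E *
    (\sum_(1 <= j < (N K).+1) normc (a j) `^ p)%:E)%E).
    by rewrite -EFinM lee_fin; exact: partial.
  rewrite lee_wpmul2l ?lee_fin ?powR_ge0// -sumEFin.
  by apply: nneseries_lim_ge => *; rewrite lee_fin powR_ge0.
have B0 : (0 <= \sum_(1 <= k <oo) (normalized_sum a s (n k) `^ p)%:E)%E.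
  by apply: nneseries_ge0 => *; rewrite lee_fin powR_ge0.
have CA0 : (0 <= (C `^ p)%:E * A)%E by rewrite mule_ge0// lee_fin powR_ge0.
apply: le_trans (gt0_ler_poweR _ _ _ sum_le) _.
- by rewrite divr_ge0// ltW.
- by rewrite in_itv/= B0 leey.
- by rewrite in_itv/= CA0 leey.
rewrite poweRM ?lee_fin ?powR_ge0// poweR_EFin -powRrM div1r mulfV ?gt_eqF//.
by rewrite powRr1.
Qed.
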